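(* Let $\varepsilon\ge0$ and $\mu^\varepsilon\in\mathcal P(\Omega)$. Then $\mu^\varepsilon$ is an $\varepsilon$-mean field equilibrium, i.e. $$\int_\Omega J(\mu^\varepsilon,x)\,\mu^\varepsilon(dx)\le\min_{x\in\Omega}J(\mu^\varepsilon,x)+\varepsilon,$$ if and only if it satisfies the $\varepsilon$-variational inequality $$\langle J(\mu^\varepsilon,\cdot),\eta-\mu^\varepsilon\rangle\ge-\varepsilon\qquad\forall\,\eta\in\mathcal P(\Omega).$$
   Context: $\Omega\subset\mathbb R^d$ is a nonempty compact set, $\mathcal P(\Omega)$ is the set of Borel probability measures on $\Omega$, and $J:\mathcal P(\Omega)\times\Omega\to\mathbb R$ is such that $J(\mu,\cdot)\in C(\Omega)$ for every $\mu\in\mathcal P(\Omega)$. For $f\in C(\Omega)$ and a finite signed measure $\xi$, $\langle f,\xi\rangle:=\int_\Omega f\,d\xi$. *)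

(* Defs.v *)
From HB Require Import structures.
From mathcomp Require Import all_boot all_order all_algebra.
From mathcomp Require Import all_classical all_reals all_analysis.
Import Order.TTheory GRing.Theory Num.Theory.
Import numFieldNormedType.Exports.

Set Implicit Arguments.
Unset Strict Implicit.
Unset Printing Implicit Defensive.

Local Open Scope classical_set_scope.
Local Open Scope ring_scope.

(* [set_type A] with its subspace topology; the proof [A0] is only there
   because measurable types are required to be pointed. *)
Definition subspace_type (X : topologicalType) (A : set X) (A0 : A !=set0) :
  Type := set_type A.

Section subspace_type.
Variables (X : topologicalType) (A : set X) (A0 : A !=set0).

Definition subspace_type_point : subspace_type A0 :=
  exist _ (projT1 (cid A0)) (mem_set (projT2 (cid A0))).

HB.instance Definition _ := Topological.copy (subspace_type A0) (set_type A).
HB.instance Definition _ :=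
  isPointed.Build (subspace_type A0) subspace_type_point.

End subspace_type.

Definition borel (T : ptopologicalType) := g_sigma_algebraType (@open T).

HB.instance Definition _ (T : ptopologicalType) :=
  Measurable.copy (borel T) (g_sigma_algebraType (@open T)).

Definition prob_on (R : realType) (X : topologicalType) (A : set X)
    (A0 : A !=set0) :=
  probability (borel (subspace_type A0)) R.

Section charge_pairing.
Context d (T : measurableType d) (R : realType).

(* The integral against a signed measure is defined by its Jordan
   decomposition, which does not depend on the Hahn decomposition chosen. *)
Definition hahn_pos (xi : {charge set T -> \bar R}) : set T :=
  projT1 (cid (Hahn_decomposition xi)).

Definition hahn_neg (xi : {charge set T -> \bar R}) : set T :=
  projT1 (cid (projT2 (cid (Hahn_decomposition xi)))).

Definition hahn_posneg (xi : {charge set T -> \bar R}) :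
    hahn_decomposition xi (hahn_pos xi) (hahn_neg xi) :=
  projT2 (cid (projT2 (cid (Hahn_decomposition xi)))).

Definition pairing (f : T -> R) (xi : {charge set T -> \bar R}) : R :=
  \int[jordan_pos (hahn_posneg xi)]_x f x
  - \int[jordan_neg (hahn_posneg xi)]_x f x.

Definition prob_sub (eta mu : probability T R) : {charge set T -> \bar R} :=
  cadd (charge_of_finite_measure eta) (copp (charge_of_finite_measure mu)).

End charge_pairing.

(* The least value of [f]; unspecified when there is none. *)
Definition min_value (R : realType) (T : Type) (f : T -> R) : R :=
  get [set m | range f m /\ lbound (range f) m].

Section equilibrium.
Context (R : realType) (X : topologicalType) (Omega : set X).
Variable Omega0 : Omega !=set0.
Variable J : prob_on R Omega0 -> subspace_type Omega0 -> R.

Definition mean_field_equilibrium (eps : R) (mu : prob_on R Omega0) : Prop :=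
  \int[mu]_x J mu x <= min_value (J mu) + eps.

Definition variational_inequality (eps : R) (mu : prob_on R Omega0) : Prop :=
  forall eta : prob_on R Omega0,
    pairing (J mu : borel (subspace_type Omega0) -> R) (prob_sub eta mu)
    >= - eps.

End equilibrium.

(* Main.v *)
Require Import Defs.
From mathcomp Require Import all_boot all_order all_algebra.
From mathcomp Require Import all_classical all_reals all_analysis.
From mathcomp Require Import lra.
Import Order.TTheory GRing.Theory Num.Theory.
Import numFieldNormedType.Exports.
Local Open Scope classical_set_scope.
Local Open Scope ring_scope.

(** Pairing [f] with [eta - mu] is the difference of the two integrals of [f]:
    if [eta - mu = p - n] is a Jordan decomposition, then [eta + n] and
    [mu + p] are the same positive measure, so they give [f] the same
    integral, and additivity of the integral in the measure separates the
    terms ([pairing_prob_sub]).  All integrals involved are finite because a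
    continuous function on a compact space is bounded and Borel
    ([continuous_integrable]).  The variational inequality thus says that
    [\int f dmu <= \int f deta + eps] for every [eta].

    The two conditions now compare [\int f dmu - eps] with the least value of
    [f] and with all averages of [f].  An average of [f] is at least its
    minimum; conversely the minimum, attained at some [x0] by compactness, is
    itself the average of [f] against the Dirac mass at [x0]. *)

(** Compactness passes to the initial topology along the inclusion: the image
    of a filter on [set_type A] contains [A], hence clusters at some point of
    [A], and every neighbourhood of the corresponding point of the subtype
    contains the trace of an open set of [X]. *)
Lemma compact_subspace_type (X : topologicalType) (A : set X) (A0 : A !=set0) :
  compact A -> compact [set: subspace_type A0].
Proof.
move=> cA F PF _.
pose incl (u : subspace_type A0) : X := \val u.
have FA : F (incl @^-1` A) by apply: filterE => u; exact: (set_mem (valP u)).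
have [p [Ap clp]] := cA (incl @ F) _ FA.
exists (exist _ p (mem_set Ap)); split=> // B U FB [_ [[W oW <-] Wp WU]].
have FB' : F (incl @^-1` (incl @` B)) by apply: filterS FB => u Bu; exists u.
have [_ [[u Bu <-] Wu]] := clp _ _ FB' (open_nbhs_nbhs (conj oW Wp)).
by exists u; split=> //; exact: WU.
Qed.

Lemma continuous_borel_measurable (R : realType) (T : ptopologicalType)
    (f : T -> R) :
  continuous f -> measurable_fun setT (f : borel T -> R).
Proof.
move=> /continuousP cf; apply: (measurability _ (measurable_realfun.RGenOpens.measurableE R)).
move=> _ [_ [a [b ->] <-]]; rewrite setTI.
by apply: sub_sigma_algebra; exact/cf/interval_open.
Qed.

Lemma continuous_integrable (R : realType) (T : ptopologicalType)
    (mu : {finite_measure set (borel T) -> \bar R}) (f : T -> R) :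
  compact [set: T] -> continuous f ->
  mu.-integrable setT (EFin \o (f : borel T -> R)).
Proof.
move=> cT cf; apply: measurable_bounded_integrable => //.
- by rewrite ltey_eq fin_num_measure.
- exact: continuous_borel_measurable.
- have cfT : {within [set: T], continuous f} by exact: continuous_subspaceT.
  have /compact_bounded[M [Mreal Mf]] := continuous_compact cfT cT.
  exists M; split=> // N MN x _.
  by apply: (Mf N MN); exists x.
Qed.

Lemma Rintegral_measure_add d (T : measurableType d) (R : realType)
    (m1 m2 : {measure set T -> \bar R}) (f : T -> R) :
  m1.-integrable setT (EFin \o f) -> m2.-integrable setT (EFin \o f) ->
  \int[measure_add m1 m2]_x f x = \int[m1]_x f x + \int[m2]_x f x.
Proof.
move=> f1 f2; rewrite /Rintegral integral_measure_add //.
  by rewrite fineD //; [exact: integrable_fin_num f1|exact: integrable_fin_num f2].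
Qed.

(** The subtraction defining the charge is traded for an equality of positive
    measures, because the integral is additive only in positive measures. *)
Lemma pairing_prob_sub d (T : measurableType d) (R : realType)
    (eta mu : probability T R) (f : T -> R) :
  (forall nu : {finite_measure set T -> \bar R},
    nu.-integrable setT (EFin \o f)) ->
  pairing f (prob_sub eta mu) = \int[eta]_x f x - \int[mu]_x f x.
Proof.
move=> fint; rewrite /pairing.
set PN := hahn_posneg _; set p := jordan_pos PN; set n := jordan_neg PN.
have transpose (a b c e : \bar R) : a \is a fin_num -> b \is a fin_num ->
    c \is a fin_num -> e \is a fin_num -> (a - b = c - e -> a + e = b + c)%E.
  move: a b c e => [a| |] [b| |] [c| |] [e| |] //= _ _ _ _.
  by move=> [h]; congr EFin; lra.
have pn A : measurable A -> (measure_add eta n A = measure_add mu p A)%E.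
  move=> mA; rewrite !measure_addE.
  apply: transpose; try exact: fin_num_measure.
  by have := jordan_decomp PN mA; rewrite /cadd /= cscaleN1.
have : \int[measure_add eta n]_x f x = \int[measure_add mu p]_x f x.
  by rewrite /Rintegral; congr fine; apply: eq_measure_integral => A /pn.
rewrite !Rintegral_measure_add; try exact: fint.
have transposeR (a b c e : R) : a + e = b + c -> c - e = a - b by lra.
exact: transposeR.
Qed.

Lemma min_valueE (R : realType) (T : Type) (f : T -> R) (x0 : T) :
  (forall x, f x0 <= f x) -> min_value f = f x0.
Proof.
move=> fmin; rewrite /min_value; set S := [set m | _].
have [[x _ fx] lb] : S (get S).
  by apply: getPex; exists (f x0); split; [exists x0|move=> _ [x _ <-]].
apply/eqP; rewrite eq_le -{2}fx fmin andbT.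
by apply: lb; exists x0.
Qed.

Theorem proposition3p2 (R : realType) (d : nat) (Omega : set 'rV[R]_d)
    (Omega0 : Omega !=set0) (Omega_compact : compact Omega)
    (J : prob_on R Omega0 -> subspace_type Omega0 -> R)
    (J_continuous : forall mu : prob_on R Omega0, continuous (J mu))
    (eps : R) (eps_ge0 : 0 <= eps) (mu : prob_on R Omega0) :
  mean_field_equilibrium J eps mu <-> variational_inequality J eps mu.
Proof.
have cOmega := compact_subspace_type _ _ Omega0 Omega_compact.
have Jint (nu : {finite_measure set (borel (subspace_type Omega0)) -> \bar R}) :
    nu.-integrable setT
      (EFin \o (J mu : borel (subspace_type Omega0) -> R)).
  by apply: continuous_integrable.
have pairE eta := pairing_prob_sub _ _ _ eta mu _ Jint.
have [x0 _ x0min] : exists2 c, c \in [set: subspace_type Omega0] &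
    forall t, t \in [set: subspace_type Omega0] -> J mu c <= J mu t.
  apply: compact_EVT_min => //; first by exists point.
  exact: continuous_subspaceT.
have Jmin x : J mu x0 <= J mu x by apply: x0min; rewrite inE.
rewrite /mean_field_equilibrium /variational_inequality (min_valueE _ _ _ _ Jmin).
split=> [mfe eta|vi].
- rewrite pairE.
  have : J mu x0 <= \int[eta]_x J mu x.
    (* the constant is the average of itself, as [eta] has total mass one *)
    rewrite -[leLHS]mulr1 -[X in _ * X]/(fine 1%:E) -(probability_setT eta).
    rewrite -Rintegral_cst //; apply: le_Rintegral => //; last exact: Jint.
    exact: finite_measure_integrable_cst.
  lra.
- have := vi \d_(x0 : borel (subspace_type Omega0)).
  rewrite pairE [X in X - _](_ : _ = J mu x0); first lra.
  rewrite /Rintegral integral_dirac //; last exact: measurable_int (Jint mu).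
  by rewrite diracT mul1e.
Qed.
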